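(* Let $N_x,N_y\geq 1$, $a_1=X_0<X_1<\dots<X_{N_x}=b_1$, $a_2=Y_0<Y_1<\dots<Y_{N_y}=b_2$, and $\Omega_{ij}=[X_i,X_{i+1}]\times[Y_j,Y_{j+1}]$ for $0\leq i\leq N_x-1$, $0\leq j\leq N_y-1$. For functions $u_{e_{ij}}:\Omega_{ij}\to\mathbb{R}$ consider the $C^1$ continuity conditions $$(\ast)\quad\begin{aligned}&u_{e_{ij}}(X_{i+1},y)=u_{e_{i+1,j}}(X_{i+1},y),\quad \frac{\partial u_{e_{ij}}}{\partial x}(X_{i+1},y)=\frac{\partial u_{e_{i+1,j}}}{\partial x}(X_{i+1},y),\\&\qquad y\in[Y_j,Y_{j+1}],\ 0\leq i\leq N_x-2,\ 0\leq j\leq N_y-1;\\&u_{e_{ij}}(x,Y_{j+1})=u_{e_{i,j+1}}(x,Y_{j+1}),\quad \frac{\partial u_{e_{ij}}}{\partial y}(x,Y_{j+1})=\frac{\partial u_{e_{i,j+1}}}{\partial y}(x,Y_{j+1}),\\&\qquad x\in[X_i,X_{i+1}],\ 0\leq i\leq N_x-1,\ 0\leq j\leq N_y-2.\end{aligned}$$ Given functions $g_{e_{ij}}$ on $\Omega_{ij}$ ($0\leq i\leq N_x-1$, $0\leq j\leq N_y-1$), $\hat G^{(1)}_{ij},\hat G^{(2)}_{ij}$ on $[Y_j,Y_{j+1}]$ ($0\leq i\leq N_x$, $0\leq j\leq N_y-1$), $\hat H^{(1)}_{ij},\hat H^{(2)}_{ij}$ on $[X_i,X_{i+1}]$ ($0\leq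 i\leq N_x-1$, $0\leq j\leq N_y$), and parameters $\hat\alpha_{ij},\hat\beta^{(1)}_{ij},\hat\beta^{(2)}_{ij},\hat\gamma_{ij}\in\mathbb{R}$ ($0\leq i\leq N_x$, $0\leq j\leq N_y$), put $$\begin{aligned}G^{(1)}_{ij}(y)=\ &\hat G^{(1)}_{ij}(y)+[\hat\alpha_{ij}-\hat G^{(1)}_{ij}(Y_j)]\psi_0(Y_j,Y_{j+1},y)+[\hat\alpha_{i,j+1}-\hat G^{(1)}_{ij}(Y_{j+1})]\psi_1(Y_j,Y_{j+1},y)\\&+[\hat\beta^{(2)}_{ij}-\hat G^{(1)}_{ij,y}(Y_j)]\varphi_0(Y_j,Y_{j+1},y)+[\hat\beta^{(2)}_{i,j+1}-\hat G^{(1)}_{ij,y}(Y_{j+1})]\varphi_1(Y_j,Y_{j+1},y),\\ G^{(2)}_{ij}(y)=\ &\hat G^{(2)}_{ij}(y)+[\hat\beta^{(1)}_{ij}-\hat G^{(2)}_{ij}(Y_j)]\psi_0(Y_j,Y_{j+1},y)+[\hat\beta^{(1)}_{i,j+1}-\hat G^{(2)}_{ij}(Y_{j+1})]\psi_1(Y_j,Y_{j+1},y)\\&+[\hat\gamma_{ij}-\hat G^{(2)}_{ij,y}(Y_j)]\varphi_0(Y_j,Y_{j+1},y)+[\hat\gamma_{i,j+1}-\hat G^{(2)}_{ij,y}(Y_{j+1})]\varphi_1(Y_j,Y_{j+1},y),\\ H^{(1)}_{ij}(x)=\ &\hat H^{(1)}_{ij}(x)+[\hat\alpha_{ij}-\hat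 H^{(1)}_{ij}(X_i)]\psi_0(X_i,X_{i+1},x)+[\hat\alpha_{i+1,j}-\hat H^{(1)}_{ij}(X_{i+1})]\psi_1(X_i,X_{i+1},x)\\&+[\hat\beta^{(1)}_{ij}-\hat H^{(1)}_{ij,x}(X_i)]\varphi_0(X_i,X_{i+1},x)+[\hat\beta^{(1)}_{i+1,j}-\hat H^{(1)}_{ij,x}(X_{i+1})]\varphi_1(X_i,X_{i+1},x),\\ H^{(2)}_{ij}(x)=\ &\hat H^{(2)}_{ij}(x)+[\hat\beta^{(2)}_{ij}-\hat H^{(2)}_{ij}(X_i)]\psi_0(X_i,X_{i+1},x)+[\hat\beta^{(2)}_{i+1,j}-\hat H^{(2)}_{ij}(X_{i+1})]\psi_1(X_i,X_{i+1},x)\\&+[\hat\gamma_{ij}-\hat H^{(2)}_{ij,x}(X_i)]\varphi_0(X_i,X_{i+1},x)+[\hat\gamma_{i+1,j}-\hat H^{(2)}_{ij,x}(X_{i+1})]\varphi_1(X_i,X_{i+1},x),\end{aligned}$$ for the same index ranges as the corresponding hatted functions, and consider, for $0\leq i\leq N_x-1$, $0\leq j\leq N_y-1$ and $(x,y)\in\Omega_{ij}$, $$(\ast\ast)\qquad u_{e_{ij}}(x,y)=g_{e_{ij}}(x,y)-\mathbf{w}_1^T(x)\mathbf{Q}_g\mathbf{w}_2(y)+\mathbf{w}_1^T(x)\mathbf{Q}_b\mathbf{w}_2(y),$$ where $$\mathbf{w}_1(x)=\begin{bmatrix}1\\ \psi_0(X_i,X_{i+1},x)\\ \psi_1(X_i,X_{i+1},x)\\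 \varphi_0(X_i,X_{i+1},x)\\ \varphi_1(X_i,X_{i+1},x)\end{bmatrix},\qquad \mathbf{w}_2(y)=\begin{bmatrix}1\\ \psi_0(Y_j,Y_{j+1},y)\\ \psi_1(Y_j,Y_{j+1},y)\\ \varphi_0(Y_j,Y_{j+1},y)\\ \varphi_1(Y_j,Y_{j+1},y)\end{bmatrix},$$ and, writing $g=g_{e_{ij}}$, $$\mathbf{Q}_g=\begin{bmatrix}0&g(x,Y_j)&g(x,Y_{j+1})&g_y(x,Y_j)&g_y(x,Y_{j+1})\\ g(X_i,y)&-g(X_i,Y_j)&-g(X_i,Y_{j+1})&-g_y(X_i,Y_j)&-g_y(X_i,Y_{j+1})\\ g(X_{i+1},y)&-g(X_{i+1},Y_j)&-g(X_{i+1},Y_{j+1})&-g_y(X_{i+1},Y_j)&-g_y(X_{i+1},Y_{j+1})\\ g_x(X_i,y)&-g_x(X_i,Y_j)&-g_x(X_i,Y_{j+1})&-g_{xy}(X_i,Y_j)&-g_{xy}(X_i,Y_{j+1})\\ g_x(X_{i+1},y)&-g_x(X_{i+1},Y_j)&-g_x(X_{i+1},Y_{j+1})&-g_{xy}(X_{i+1},Y_j)&-g_{xy}(X_{i+1},Y_{j+1})\end{bmatrix},$$ $$\mathbf{Q}_b=\begin{bmatrix}0&H^{(1)}_{ij}(x)&H^{(1)}_{i,j+1}(x)&H^{(2)}_{ij}(x)&H^{(2)}_{i,j+1}(x)\\ G^{(1)}_{ij}(y)&-\hat\alpha_{ij}&-\hat\alpha_{i,j+1}&-\hat\beta^{(2)}_{ij}&-\hat\beta^{(2)}_{i,j+1}\\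 G^{(1)}_{i+1,j}(y)&-\hat\alpha_{i+1,j}&-\hat\alpha_{i+1,j+1}&-\hat\beta^{(2)}_{i+1,j}&-\hat\beta^{(2)}_{i+1,j+1}\\ G^{(2)}_{ij}(y)&-\hat\beta^{(1)}_{ij}&-\hat\beta^{(1)}_{i,j+1}&-\hat\gamma_{ij}&-\hat\gamma_{i,j+1}\\ G^{(2)}_{i+1,j}(y)&-\hat\beta^{(1)}_{i+1,j}&-\hat\beta^{(1)}_{i+1,j+1}&-\hat\gamma_{i+1,j}&-\hat\gamma_{i+1,j+1}\end{bmatrix}.$$ Then: (i) For arbitrary functions $g_{e_{ij}},\hat G^{(1)}_{ij},\hat G^{(2)}_{ij},\hat H^{(1)}_{ij},\hat H^{(2)}_{ij}$ and arbitrary parameter values $\hat\alpha_{ij},\hat\beta^{(1)}_{ij},\hat\beta^{(2)}_{ij},\hat\gamma_{ij}$, the functions $u_{e_{ij}}$ given by $(\ast\ast)$ satisfy $(\ast)$. (ii) Any piecewise function, given by functions $u_{e_{ij}}$ on $\Omega_{ij}$ ($0\leq i\leq N_x-1$, $0\leq j\leq N_y-1$) satisfying $(\ast)$, can be expressed in the form $(\ast\ast)$ for some $g_{e_{ij}},\hat G^{(1)}_{ij},\hat G^{(2)}_{ij},\hat H^{(1)}_{ij},\hat H^{(2)}_{ij}$ and some values of the parameters $\hat\alpha_{ij},\hat\beta^{(1)}_{ij},\hat\beta^{(2)}_{ij},\hat\gamma_{ij}$.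
   Context: For real numbers $s<t$ set $\phi_0(s,t,x)=\dfrac{t-x}{t-s}$, $\phi_1(s,t,x)=\dfrac{x-s}{t-s}$, and (writing $\phi_k=\phi_k(s,t,x)$, with $\phi_k'$ its derivative in $x$) $$\psi_0(s,t,x)=3\phi_0^2-2\phi_0^3,\quad \psi_1(s,t,x)=3\phi_1^2-2\phi_1^3,$$ $$\varphi_0(s,t,x)=\left[\phi_0'|_{x=s}\right]^{-1}\left(\phi_0^3-\phi_0^2\right),\quad \varphi_1(s,t,x)=\left[\phi_1'|_{x=t}\right]^{-1}\left(\phi_1^3-\phi_1^2\right).$$ The element $\Omega_{ij}$ has index $e_{ij}=iN_y+j$, so $u_{e_{ij}}$ is simply the function attached to $\Omega_{ij}$. Subscripts denote derivatives: $g_x=\partial g/\partial x$, $g_y=\partial g/\partial y$, $g_{xy}=\partial^2g/\partial x\partial y$, $\hat G^{(k)}_{ij,y}=d\hat G^{(k)}_{ij}/dy$, $\hat H^{(k)}_{ij,x}=d\hat H^{(k)}_{ij}/dx$. Derivatives at boundary points are one-sided. Regularity convention: the free functions $g_{e_{ij}}$, and the given functions $u_{e_{ij}}$ in part (ii), are of class $C^2$ on the closed rectangle $\Omega_{ij}$; the free functions $\hat G^{(k)}_{ij},\hat H^{(k)}_{ij}$ are of class $C^1$ on their closed intervals. *)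

(* Defs.v *)
From HB Require Import structures.
From mathcomp Require Import all_boot all_order all_algebra.
From mathcomp Require Import all_classical all_reals all_analysis.

Set Implicit Arguments.
Unset Strict Implicit.
Unset Printing Implicit Defensive.

Import Order.TTheory GRing.Theory Num.Theory.
Import numFieldNormedType.Exports.

Local Open Scope classical_set_scope.
Local Open Scope ring_scope.

(** A function on a closed interval or rectangle is encoded as a total function
    on [R] or [R -> R]; derivatives and regularity are relative to the closed
    domain, so that the values outside of it are never used. *)

Section Regularity.
Context {R : realType}.
Implicit Types (a b c d s t x y : R).

Definition diffquot_filter a b (f : R -> R) x : set_system R :=
  (fun z => (f z - f x) / (z - x)) @ within `[a, b] x^'.

(** For [x] in [`[a, b]] with [a < b]: two-sided at interior points, one-sided
    at [a] and [b]. *)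
Definition derivable_on a b (f : R -> R) x : Prop :=
  cvg (diffquot_filter a b f x).

Definition derive_on a b (f : R -> R) x : R := lim (diffquot_filter a b f x).

Definition C1_itv a b (f : R -> R) : Prop :=
  [/\ {within `[a, b], continuous f},
      forall x, x \in `[a, b] -> derivable_on a b f x &
      {within `[a, b], continuous (derive_on a b f)}].

(** Partial derivatives of a function on [`[a, b] `*` `[c, d]]. *)
Definition Dx a b (f : R -> R -> R) : R -> R -> R :=
  fun x y => derive_on a b (f^~ y) x.

Definition Dy c d (f : R -> R -> R) : R -> R -> R :=
  fun x y => derive_on c d (f x) y.

Definition C0_rect a b c d (f : R -> R -> R) : Prop :=
  {within `[a, b] `*` `[c, d], continuous (fun p : R * R => f p.1 p.2)}.

Definition C1_rect a b c d (f : R -> R -> R) : Prop :=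
  [/\ forall x y, x \in `[a, b] -> y \in `[c, d] ->
        derivable_on a b (f^~ y) x /\ derivable_on c d (f x) y,
      C0_rect a b c d f,
      C0_rect a b c d (Dx a b f) &
      C0_rect a b c d (Dy c d f)].

Definition C2_rect a b c d (f : R -> R -> R) : Prop :=
  [/\ C1_rect a b c d f, C1_rect a b c d (Dx a b f) &
      C1_rect a b c d (Dy c d f)].

End Regularity.

Section Hermite.
Context {R : realType}.
Implicit Types (s t x : R).

Definition phi0 s t x : R := (t - x) / (t - s).
Definition phi1 s t x : R := (x - s) / (t - s).

Definition psi0 s t x : R := 3 * phi0 s t x ^+ 2 - 2 * phi0 s t x ^+ 3.
Definition psi1 s t x : R := 3 * phi1 s t x ^+ 2 - 2 * phi1 s t x ^+ 3.

Definition varphi0 s t x : R :=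
  (derive1 (phi0 s t) s)^-1 * (phi0 s t x ^+ 3 - phi0 s t x ^+ 2).
Definition varphi1 s t x : R :=
  (derive1 (phi1 s t) t)^-1 * (phi1 s t x ^+ 3 - phi1 s t x ^+ 2).

(** The correction turning the free function [f] on [`[s, t]] into a function
    with values [v0], [v1] and derivatives [d0], [d1] at [s], [t]. *)
Definition hermite_correct s t (f : R -> R) (v0 v1 d0 d1 : R) x : R :=
  f x + (v0 - f s) * psi0 s t x + (v1 - f t) * psi1 s t x
      + (d0 - derive_on s t f s) * varphi0 s t x
      + (d1 - derive_on s t f t) * varphi1 s t x.

Definition wvec s t x : 'cV[R]_5 :=
  \col_(k < 5) [:: 1; psi0 s t x; psi1 s t x; varphi0 s t x; varphi1 s t x]`_k.

Definition mx5 (rows : seq (seq R)) : 'M[R]_5 :=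
  \matrix_(k < 5, l < 5) (nth [::] rows k)`_l.

End Hermite.

Section Elements.
Context {R : realType}.
Implicit Types (Nx Ny i j : nat) (X Y : nat -> R) (u : nat -> nat -> R -> R -> R).

(** The families below are indexed by all of [nat]; only the indices occurring
    in the mesh are constrained. [u i j] is the function attached to the
    element [`[X i, X i.+1] `*` `[Y j, Y j.+1]]. *)

Definition is_grid (N : nat) (a b : R) (X : nat -> R) : Prop :=
  [/\ X 0%N = a, X N = b & forall i, (i < N)%N -> X i < X i.+1].

Record free_data := FreeData {
  fg : nat -> nat -> R -> R -> R;
  hG1 : nat -> nat -> R -> R;
  hG2 : nat -> nat -> R -> R;
  hH1 : nat -> nat -> R -> R;
  hH2 : nat -> nat -> R -> R;
  alpha : nat -> nat -> R;
  beta1 : nat -> nat -> R;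
  beta2 : nat -> nat -> R;
  gamma : nat -> nat -> R }.

Definition C2_elements Nx Ny X Y u : Prop :=
  forall i j, (i < Nx)%N -> (j < Ny)%N ->
    C2_rect (X i) (X i.+1) (Y j) (Y j.+1) (u i j).

Definition free_data_regular Nx Ny X Y (D : free_data) : Prop :=
  [/\ C2_elements Nx Ny X Y (fg D),
      forall i j, (i <= Nx)%N -> (j < Ny)%N ->
        C1_itv (Y j) (Y j.+1) (hG1 D i j) /\
        C1_itv (Y j) (Y j.+1) (hG2 D i j) &
      forall i j, (i < Nx)%N -> (j <= Ny)%N ->
        C1_itv (X i) (X i.+1) (hH1 D i j) /\
        C1_itv (X i) (X i.+1) (hH2 D i j)].

(** Equality of derivatives includes their existence. *)
Definition C1_continuity Nx Ny X Y u : Prop :=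
  (forall i j y, (i.+1 < Nx)%N -> (j < Ny)%N -> y \in `[Y j, Y j.+1] ->
     [/\ u i j (X i.+1) y = u i.+1 j (X i.+1) y,
         derivable_on (X i) (X i.+1) ((u i j)^~ y) (X i.+1),
         derivable_on (X i.+1) (X i.+2) ((u i.+1 j)^~ y) (X i.+1) &
         Dx (X i) (X i.+1) (u i j) (X i.+1) y =
         Dx (X i.+1) (X i.+2) (u i.+1 j) (X i.+1) y]) /\
  (forall i j x, (i < Nx)%N -> (j.+1 < Ny)%N -> x \in `[X i, X i.+1] ->
     [/\ u i j x (Y j.+1) = u i j.+1 x (Y j.+1),
         derivable_on (Y j) (Y j.+1) (u i j x) (Y j.+1),
         derivable_on (Y j.+1) (Y j.+2) (u i j.+1 x) (Y j.+1) &
         Dy (Y j) (Y j.+1) (u i j) x (Y j.+1) =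
         Dy (Y j.+1) (Y j.+2) (u i j.+1) x (Y j.+1)]).

Section Form.
Variables (X Y : nat -> R) (D : free_data).
Implicit Types (x y : R).

Definition G1 i j : R -> R :=
  hermite_correct (Y j) (Y j.+1) (hG1 D i j)
    (alpha D i j) (alpha D i j.+1) (beta2 D i j) (beta2 D i j.+1).

Definition G2 i j : R -> R :=
  hermite_correct (Y j) (Y j.+1) (hG2 D i j)
    (beta1 D i j) (beta1 D i j.+1) (gamma D i j) (gamma D i j.+1).

Definition H1 i j : R -> R :=
  hermite_correct (X i) (X i.+1) (hH1 D i j)
    (alpha D i j) (alpha D i.+1 j) (beta1 D i j) (beta1 D i.+1 j).

Definition H2 i j : R -> R :=
  hermite_correct (X i) (X i.+1) (hH2 D i j)
    (beta2 D i j) (beta2 D i.+1 j) (gamma D i j) (gamma D i.+1 j).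

Definition Qg i j x y : 'M[R]_5 :=
  let: (x0, x1, y0, y1) := (X i, X i.+1, Y j, Y j.+1) in
  let g := fg D i j in
  let gx := Dx x0 x1 g in
  let gy := Dy y0 y1 g in
  let gxy := Dx x0 x1 gy in
  mx5 [:: [:: 0; g x y0; g x y1; gy x y0; gy x y1];
          [:: g x0 y; - g x0 y0; - g x0 y1; - gy x0 y0; - gy x0 y1];
          [:: g x1 y; - g x1 y0; - g x1 y1; - gy x1 y0; - gy x1 y1];
          [:: gx x0 y; - gx x0 y0; - gx x0 y1; - gxy x0 y0; - gxy x0 y1];
          [:: gx x1 y; - gx x1 y0; - gx x1 y1; - gxy x1 y0; - gxy x1 y1]].

Definition Qb i j x y : 'M[R]_5 :=
  let: (al, be1, be2, ga) := (alpha D, beta1 D, beta2 D, gamma D) in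
  mx5 [:: [:: 0; H1 i j x; H1 i j.+1 x; H2 i j x; H2 i j.+1 x];
          [:: G1 i j y;
              - al i j; - al i j.+1; - be2 i j; - be2 i j.+1];
          [:: G1 i.+1 j y;
              - al i.+1 j; - al i.+1 j.+1; - be2 i.+1 j; - be2 i.+1 j.+1];
          [:: G2 i j y;
              - be1 i j; - be1 i j.+1; - ga i j; - ga i j.+1];
          [:: G2 i.+1 j y;
              - be1 i.+1 j; - be1 i.+1 j.+1; - ga i.+1 j; - ga i.+1 j.+1]].

Definition tfc_expr i j x y : R :=
  let w1 := wvec (X i) (X i.+1) x in
  let w2 := wvec (Y j) (Y j.+1) y in
  fg D i j x y - (w1^T *m Qg i j x y *m w2) 0 0
               + (w1^T *m Qb i j x y *m w2) 0 0.

End Form.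

Definition has_tfc_form Nx Ny X Y (D : free_data) u : Prop :=
  forall i j, (i < Nx)%N -> (j < Ny)%N ->
  forall x y, x \in `[X i, X i.+1] -> y \in `[Y j, Y j.+1] ->
    u i j x y = tfc_expr X Y D i j x y.

End Elements.

Arguments free_data R : clear implicits.

(* Main.v *)
Require Import Defs.
From mathcomp Require Import all_boot all_order all_algebra.
From mathcomp Require Import all_classical all_reals all_analysis.
From mathcomp Require Import ring lra zify.

(** On an interval [s, t], let [hermite_data s t k f], for k < 4, be the values
    of [f] at [s] and [t] followed by its derivatives there.  The four cubics
    psi_0, psi_1, varphi_0, varphi_1 are the dual basis
    ([hermite_data_basis]), so [hermite_correct] prescribes these four numbers
    at will.

    Either product of the vectors w with a matrix Q is a Boolean sum
      sum_l b_l(y) H_l(x) + sum_k b_k(x) G_k(y) - sum_kl b_k(x) b_l(y) C_kl,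
    which matches the prescribed data H_l on the horizontal edges and G_k on
    the vertical edges as soon as the data agree at the corners, that is, as
    soon as both the k-th datum of H_l and the l-th datum of G_k are C_kl
    ([hermite_data_boolean_sum]; [boolean_sum_swap] exchanges x and y).

    Part (i).  The corrections built into the functions H and G make them
    compatible with the parameters at the vertices.  The data of [g] itself are
    compatible because the mixed derivatives of [g] agree at the corners, by
    Schwarz's theorem on the closed rectangle ([Dx_DyC]).  Hence the data of
    [g] cancel, and the data of [u] on each edge are exactly the functions G or
    H attached to that edge ([tfc_form_data_x], [tfc_form_data_y]); two
    adjacent elements share these functions.

    Part (ii).  Take g = u, and take for the hatted functions and the
    parameters the traces of [u] and of its derivatives on the edges and at the
    nodes, read off from one element adjacent to each edge or node.  The
    continuity conditions, differentiated along the edges, show that the choice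
    of the element does not matter; for the mixed derivative this uses
    Schwarz's theorem again, since across a vertical edge it is u_x that
    matches.  Then all the Hermite corrections vanish, Q_b = Q_g, and the
    representation reduces to u = g. *)

Set Implicit Arguments.
Unset Strict Implicit.
Unset Printing Implicit Defensive.

Import Order.TTheory GRing.Theory Num.Theory.
Import numFieldNormedType.Exports.

Local Open Scope classical_set_scope.
Local Open Scope ring_scope.

(** * Derivatives relative to a closed interval *)

Section OneSidedDerivatives.
Context {R : realType}.
Implicit Types (a b x : R) (f g : R -> R).

(** Limits along this filter are unique: every point of a nondegenerate
    interval, endpoints included, is an accumulation point of it. *)
Lemma within_itv_dnbhs_proper a b x : a < b -> x \in `[a, b] ->
  ProperFilter (within `[a, b] x^').
Proof.
move=> ab; rewrite in_itv /= => /andP[ax xb].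
apply: Build_ProperFilter_ex => P; rewrite /within /dnbhs /= /within /=.
move=> /nbhs_ballP[e /= e0 He].
have [xltb|bx] := ltP x b.
- exists (Num.min b (x + e / 2)).
  have h1 : Num.min b (x + e / 2) <= b by rewrite ge_min lexx.
  have h2 : x < Num.min b (x + e / 2) by rewrite lt_min xltb /=; lra.
  have h3 : Num.min b (x + e / 2) <= x + e / 2 by rewrite ge_min lexx orbT.
  apply: He.
  + rewrite /ball /= ltr_norml; apply/andP; split; lra.
  + by rewrite gt_eqF.
  + by rewrite in_itv /= h1 andbT; lra.
- exists (Num.max a (x - e / 2)).
  have h1 : a <= Num.max a (x - e / 2) by rewrite le_max lexx.
  have h2 : Num.max a (x - e / 2) < x by rewrite gt_max; apply/andP; split; lra.
  have h3 : x - e / 2 <= Num.max a (x - e / 2) by rewrite le_max lexx orbT.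
  apply: He.
  + rewrite /ball /= ltr_norml; apply/andP; split; lra.
  + by rewrite lt_eqF.
  + by rewrite in_itv /= h1 /=; lra.
Qed.

Lemma derive_on_val a b f x l : a < b -> x \in `[a, b] ->
  diffquot_filter a b f x --> l -> derive_on a b f x = l.
Proof.
move=> ab xab fl; have := within_itv_dnbhs_proper ab xab => PF.
exact/cvg_lim.
Qed.

(** The difference quotients only depend on the values on the interval. *)
Lemma eq_diffquot_filter a b f g x : x \in `[a, b] -> {in `[a, b], f =1 g} ->
  diffquot_filter a b f x = diffquot_filter a b g x.
Proof.
move=> xab fg; rewrite /diffquot_filter.
by apply/seteqP; split; apply: near_eq_cvg; rewrite near_withinE;
  apply: nearW => z zab; rewrite (fg z zab) (fg x xab).
Qed.

Lemma eq_derivable_on a b f g x : x \in `[a, b] -> {in `[a, b], f =1 g} ->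
  derivable_on a b f x -> derivable_on a b g x.
Proof. by move=> xab fg; rewrite /derivable_on (eq_diffquot_filter xab fg). Qed.

Lemma eq_derive_on a b f g x : x \in `[a, b] -> {in `[a, b], f =1 g} ->
  derive_on a b f x = derive_on a b g x.
Proof. by move=> xab fg; rewrite /derive_on (eq_diffquot_filter xab fg). Qed.

Lemma diffquot_lin a b f g x (k l m : R) :
  diffquot_filter a b f x --> l -> diffquot_filter a b g x --> m ->
  diffquot_filter a b (fun z => f z + k * g z) x --> l + k * m.
Proof.
move=> fl gm; rewrite /diffquot_filter.
rewrite (_ : (fun z => _) = (fun z => (f z - f x) / (z - x)) \+
   (cst k \* (fun z => (g z - g x) / (z - x)))); last first.
  by apply/funext => z /=; rewrite mulrA -mulrDl; congr (_ / _); ring.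
by apply: cvgD => //; apply: cvgM => //; apply: cvg_cst.
Qed.

Lemma diffquot_cst a b (c : R) x : diffquot_filter a b (fun=> c) x --> (0 : R).
Proof.
rewrite /diffquot_filter (_ : (fun z => _) = cst 0); first exact: cvg_cst.
by apply/funext => z /=; rewrite subrr mul0r.
Qed.

Lemma dnbhs_comp_shift {T : Type} x (F : R -> T) :
  (F \o shift x) @ 0^' = F @ x^'.
Proof.
apply/funext => A; apply/propext.
rewrite /dnbhs; change ((\forall h \near 0, h != 0 -> A (F (h + x))) <->
  (\forall z \near x, z != x -> A (F z))).
rewrite (near_shift 0 x) subr0 /=.
split; apply: filterS => z H zx; apply: H.
  by apply: contra_neq zx => ->; rewrite add0r.
by apply: contra_neq zx => zx; lra.
Qed.

(** The difference quotients defining [derive], in the increment h, are those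
    of [diffquot_filter], in the variable z = x + h. *)
Lemma diffquotE f x :
  (fun h => h^-1 *: ((f \o shift x) (h *: 1) - f x)) =
  (fun z => (f z - f x) / (z - x)) \o shift x.
Proof.
apply/funext => h /=.
by rewrite addrK mulrC /GRing.scale /= mulr1.
Qed.

Lemma is_derive_diffquot a b f x l : is_derive x 1 f l ->
  diffquot_filter a b f x --> l.
Proof.
case=> [df <-]; apply: cvg_within_filter.
move: df; rewrite /derivable /derive diffquotE dnbhs_comp_shift.
exact.
Qed.

Lemma derivable_on_is_derive a b f x : x \in `]a, b[ ->
  derivable_on a b f x -> is_derive x 1 f (derive_on a b f x).
Proof.
rewrite in_itv /= => /andP[ax xb] df.
(* [`[a, b]] is a neighbourhood of [x], so the restriction is void. *)
have fx : (fun z => (f z - f x) / (z - x)) @ x^' --> derive_on a b f x.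
  apply: cvg_trans df => P; rewrite /diffquot_filter /= /fmap /= /within /=.
  have : \forall z \near x^', z \in `[a, b].
    apply: nbhs_dnbhs; have : x \in `]a, b[ by rewrite in_itv /= ax.
    move=> /near_in_itvoo; apply: filterS => z.
    by rewrite !in_itv /= => /andP[/ltW -> /ltW ->].
  by apply: filterS2 => z zab; apply.
have cd : (fun h : R => h^-1 *: ((f \o shift x) (h *: 1) - f x)) @ 0^' -->
    derive_on a b f x by rewrite diffquotE dnbhs_comp_shift.
split; first by apply/cvg_ex; exists (derive_on a b f x).
exact/cvg_lim.
Qed.

(** Differentiability relative to an interval implies continuity there. *)
Lemma derivable_on_cvg a b f x : derivable_on a b f x ->
  f @ within `[a, b] (nbhs x) --> f x.
Proof.
move=> df.
(* For z != x this function is [f]. *)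
have h : (fun z => f x + (f z - f x) / (z - x) * (z - x)) @
   within `[a, b] x^' --> f x.
  rewrite -[X in _ --> X]addr0 -(mulr0 (derive_on a b f x)) -(subrr x).
  apply: cvgD; first exact: cvg_cst.
  apply: cvgM; first exact: df.
  apply: cvgB; last exact: cvg_cst.
  apply: cvg_within_filter; apply: cvg_trans (@cvg_id _ (nbhs x)).
  exact: nbhs_dnbhs.
move=> P Px; have := h P Px; have := nbhs_singleton Px.
move=> Pfx; change ((\forall z \near x, z != x -> z \in `[a, b] ->
    P (f x + (f z - f x) / (z - x) * (z - x))) ->
  (\forall z \near x, z \in `[a, b] -> P (f z))).
apply: filterS => z H zab.
have [->//|zx] := eqVneq z x.
have := H zx zab; rewrite divfK ?subr_eq0 //.
by rewrite addrC subrK.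
Qed.

Lemma derivable_on_continuous a b f :
  (forall x, x \in `[a, b] -> derivable_on a b f x) ->
  {within `[a, b], continuous f}.
Proof.
by move=> df; apply/subspace_continuousP => x xab; apply: derivable_on_cvg;
  apply: df.
Qed.

(** The mean value theorem on a subinterval, for derivatives relative to the
    larger interval. *)
Lemma MVT_on a b f x0 x1 : a <= x0 -> x0 < x1 -> x1 <= b ->
  (forall x, x \in `[a, b] -> derivable_on a b f x) ->
  exists2 z, z \in `]x0, x1[ & f x1 - f x0 = derive_on a b f z * (x1 - x0).
Proof.
move=> ax0 x01 x1b df.
have sub : {subset `]x0, x1[ <= `]a, b[}.
  by apply/subitvP; rewrite subitvE !bnd_simp ax0.
have sub' : {subset `[x0, x1] <= `[a, b]}.
  by apply/subitvP; rewrite subitvE !bnd_simp ax0.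
apply: MVT => // [x xx|].
  apply: derivable_on_is_derive; first exact: sub.
  by apply: df; apply: subset_itv_oo_cc; exact: sub.
apply: continuous_subspaceW (derivable_on_continuous df) => z /=; exact: sub'.
Qed.

End OneSidedDerivatives.

(** * Schwarz's theorem on a closed rectangle *)

Section Schwarz.
Context {R : realType}.
Implicit Types (a b c d x y : R) (f : R -> R -> R).

(** The double difference of [f] over a sub-rectangle is a value of the mixed
    derivative times the area. *)
Lemma double_difference_MVT a b c d f x0 x1 y0 y1 :
  a <= x0 -> x0 < x1 -> x1 <= b -> c <= y0 -> y0 < y1 -> y1 <= d ->
  (forall x y, x \in `[a, b] -> y \in `[c, d] -> derivable_on c d (f x) y) ->
  (forall x y, x \in `[a, b] -> y \in `[c, d] ->
     derivable_on a b ((Dy c d f)^~ y) x) ->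
  exists2 p : R * R, (p.1 \in `]x0, x1[) /\ (p.2 \in `]y0, y1[) &
    f x1 y1 - f x0 y1 - (f x1 y0 - f x0 y0) =
    Dx a b (Dy c d f) p.1 p.2 * ((x1 - x0) * (y1 - y0)).
Proof.
move=> ax x01 xb cy y01 yd dfy dfyx.
have x0ab : x0 \in `[a, b] by rewrite in_itv /= ax /=; lra.
have x1ab : x1 \in `[a, b] by rewrite in_itv /= xb andbT; lra.
have cd : c < d by lra.
have h y : y \in `[c, d] ->
    diffquot_filter c d (fun y => f x1 y + -1 * f x0 y) y -->
    Dy c d f x1 y + -1 * Dy c d f x0 y.
  by move=> ycd; apply: diffquot_lin; apply: dfy.
have dh y : y \in `[c, d] -> derivable_on c d (fun y => f x1 y + -1 * f x0 y) y.
  by move=> /h hy; apply/cvg_ex; eexists; exact: hy.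
have [eta etay E1] := MVT_on cy y01 yd dh.
have etacd : eta \in `[c, d].
  by move: etay; rewrite !in_itv /= => /andP[? ?]; apply/andP; split; lra.
have [xi xix E2] := MVT_on ax x01 xb (fun x xab => dfyx x eta xab etacd).
exists (xi, eta) => //=.
move: E1; rewrite (derive_on_val cd etacd (h eta etacd)) => E1.
rewrite [Dx _ _ _ _ _]/Dx mulrA -E2 /=.
by lra.
Qed.

Lemma C0_rectP a b c d f x y e : C0_rect a b c d f ->
  x \in `[a, b] -> y \in `[c, d] -> 0 < e ->
  exists2 r, 0 < r & forall x' y', x' \in `[a, b] -> y' \in `[c, d] ->
    `|x - x'| < r -> `|y - y'| < r -> `|f x y - f x' y'| < e.
Proof.
move=> /subspace_continuousP cf xab ycd e0.
have /cf : (`[a, b] `*` `[c, d]) (x, y) by [].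
move=> /cvgrPdist_lt /(_ e e0) /=.
rewrite near_withinE => /nbhs_ballP[r /= r0 H].
exists r => // x' y' x'ab y'cd xx yy; by apply: (H (x', y')).
Qed.

Lemma small_subinterval a b x r : a < b -> x \in `[a, b] -> 0 < r ->
  exists l m, [/\ a <= l, l < m, m <= b &
    forall z, z \in `]l, m[ -> `|x - z| < r].
Proof.
move=> ab; rewrite in_itv /= => /andP[ax xb] r0.
exists (Num.max a (x - r)), (Num.min b (x + r)); split.
- by rewrite le_max lexx.
- by rewrite gt_max !lt_min; apply/andP; split; apply/andP; split; lra.
- by rewrite ge_min lexx.
- move=> z; rewrite in_itv /= gt_max lt_min => /andP[/andP[? ?] /andP[? ?]].
  by rewrite ltr_norml; apply/andP; split; lra.
Qed.

(** Schwarz's theorem on a closed rectangle, boundary included. *)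
Lemma Dx_DyC a b c d f x y : a < b -> c < d -> C2_rect a b c d f ->
  x \in `[a, b] -> y \in `[c, d] ->
  Dx a b (Dy c d f) x y = Dy c d (Dx a b f) x y.
Proof.
move=> ab cd [[df _ _ _] [dfx _ _ cxy] [dfy _ cyx _]] xab ycd.
apply/eqP; rewrite -subr_eq0 -normr_le0 leNgt; apply/negP => e0.
set e := `|_| in e0.
have e20 : 0 < e / 2 by lra.
have [r1 r10 H1] := C0_rectP cyx xab ycd e20.
have [r2 r20 H2] := C0_rectP cxy xab ycd e20.
have r0 : 0 < Num.min r1 r2 by rewrite lt_min r10.
(* On a small sub-rectangle, both mixed derivatives stay within [e / 2] of
   their values at [(x, y)]. *)
have [l [m [al lm mb Hlm]]] := small_subinterval ab xab r0.
have [l' [m' [cl lm' md Hlm']]] := small_subinterval cd ycd r0.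
have [|x'|[p q] /= [pl ql] E1] :=
    @double_difference_MVT a b c d f l m l' m' al lm mb cl lm' md.
- by move=> x' y' /df h /h[].
- by move=> y' hx hy; case: (dfy x' y' hx hy).
(* The same double difference, expanded in the other order. *)
have [|y'|[q' p'] /= [ql' pl'] E2] :=
    @double_difference_MVT c d a b (fun y x => f x y)
      l' m' l m cl lm' md al lm mb.
- by move=> y' x' hy hx; case: (df x' y' hx hy).
- by move=> x' hy hx; case: (dfx x' y' hx hy).
have E : Dx a b (Dy c d f) p q = Dy c d (Dx a b f) p' q'.
  have nz : (m - l) * (m' - l') != 0 by rewrite mulf_neq0 // subr_eq0 gt_eqF.
  apply: (mulIf nz); rewrite -E1.
  rewrite [X in _ = _ * X]mulrC; rewrite [RHS]/= -[RHS]E2; ring.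
have ab' z : z \in `]l, m[ -> z \in `[a, b].
  by rewrite !in_itv /= => /andP[? ?]; apply/andP; split; lra.
have cd' z : z \in `]l', m'[ -> z \in `[c, d].
  by rewrite !in_itv /= => /andP[? ?]; apply/andP; split; lra.
have small z : `|x - z| < Num.min r1 r2 -> `|x - z| < r1 /\ `|x - z| < r2.
  by rewrite lt_min => /andP[].
have small' z : `|y - z| < Num.min r1 r2 -> `|y - z| < r1 /\ `|y - z| < r2.
  by rewrite lt_min => /andP[].
have D1 := H1 p q (ab' _ pl) (cd' _ ql)
  (small _ (Hlm _ pl)).1 (small' _ (Hlm' _ ql)).1.
have D2 := H2 p' q' (ab' _ pl') (cd' _ ql')
  (small _ (Hlm _ pl')).2 (small' _ (Hlm' _ ql')).2.
move: D1 D2; rewrite E => D1 D2.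
have : e < e / 2 + e / 2.
  rewrite {1}/e (le_lt_trans (ler_distD (Dy c d (Dx a b f) p' q') _ _)) //.
  by rewrite ltrD // distrC.
by lra.
Qed.

(** Restrictions to horizontal and vertical segments. *)
Lemma C1_rect_C1_x a b c d f y : C1_rect a b c d f -> y \in `[c, d] ->
  C1_itv a b (f^~ y).
Proof.
move=> [df _ cfx _] ycd; split.
- by apply: derivable_on_continuous => x xab; case: (df x y xab ycd).
- by move=> x xab; case: (df x y xab ycd).
apply/subspace_continuousP => x xab; apply/cvgrPdist_lt => e e0.
have [r r0 H] := C0_rectP cfx xab ycd e0.
rewrite near_withinE; apply/nbhs_ballP; exists r => //= z xz zab.
by apply: H => //; rewrite subrr normr0.
Qed.

Lemma C1_rect_C1_y a b c d f x : C1_rect a b c d f -> x \in `[a, b] ->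
  C1_itv c d (f x).
Proof.
move=> [df _ _ cfy] xab; split.
- by apply: derivable_on_continuous => y ycd; case: (df x y xab ycd).
- by move=> y ycd; case: (df x y xab ycd).
apply/subspace_continuousP => y ycd; apply/cvgrPdist_lt => e e0.
have [r r0 H] := C0_rectP cfy xab ycd e0.
rewrite near_withinE; apply/nbhs_ballP; exists r => //= z yz zcd.
by apply: H => //; rewrite subrr normr0.
Qed.
End Schwarz.

(** * Cubic Hermite interpolation *)

Section HermiteFunctionals.
Context {R : realType}.
Implicit Types (s t x : R) (k l : nat) (f g : R -> R).

(** The values at [s] and [t], then the one-sided derivatives at [s] and [t];
    0 for [k >= 4]. *)
Definition hermite_data s t k f : R :=
  [:: f s; f t; derive_on s t f s; derive_on s t f t]`_k.

(** The cubics of Hermite interpolation, listed in the order of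
    [hermite_data]. *)
Definition hermite_basis s t k x : R :=
  [:: psi0 s t x; psi1 s t x; varphi0 s t x; varphi1 s t x]`_k.

(** [hermite_data s t k] is linear on functions with this property. *)
Definition derivable_ends s t f : Prop :=
  derivable_on s t f s /\ derivable_on s t f t.

Lemma lbound_in_itv s t : s < t -> s \in `[s, t].
Proof. by move=> st; rewrite in_itv /= lexx ltW. Qed.

Lemma ubound_in_itv s t : s < t -> t \in `[s, t].
Proof. by move=> st; rewrite in_itv /= lexx ltW. Qed.

Lemma C1_itv_ends s t f : s < t -> C1_itv s t f -> derivable_ends s t f.
Proof.
by move=> st [_ df _]; split; apply: df;
  [apply: lbound_in_itv|apply: ubound_in_itv].
Qed.

Lemma eq_hermite_data s t k f g : s < t -> {in `[s, t], f =1 g} ->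
  hermite_data s t k f = hermite_data s t k g.
Proof.
move=> st fg; rewrite /hermite_data.
rewrite (eq_derive_on (lbound_in_itv st) fg).
rewrite (eq_derive_on (ubound_in_itv st) fg).
by rewrite (fg s (lbound_in_itv st)) (fg t (ubound_in_itv st)).
Qed.

Lemma eq_derivable_ends s t f g : s < t -> {in `[s, t], f =1 g} ->
  derivable_ends s t f -> derivable_ends s t g.
Proof.
by move=> st fg [ds dt]; split;
  [apply: eq_derivable_on ds|apply: eq_derivable_on dt] => //;
  [apply: lbound_in_itv|apply: ubound_in_itv].
Qed.

Lemma hermite_data_lin s t f g (c : R) : s < t ->
  derivable_ends s t f -> derivable_ends s t g ->
  derivable_ends s t (fun x => f x + c * g x) /\
  forall k, hermite_data s t k (fun x => f x + c * g x) =
    hermite_data s t k f + c * hermite_data s t k g.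
Proof.
move=> st [fs ft] [gs gt].
have hs := diffquot_lin (k := c) fs gs.
have ht := diffquot_lin (k := c) ft gt.
split; first by split; apply/cvg_ex; eexists; [exact: hs|exact: ht].
rewrite /hermite_data (derive_on_val st (lbound_in_itv st) hs).
rewrite (derive_on_val st (ubound_in_itv st) ht).
by case=> [|[|[|[|k]]]] //=; rewrite nth_nil; ring.
Qed.

Lemma hermite_data_cst s t (c : R) : s < t ->
  derivable_ends s t (fun=> c) /\
  forall k, hermite_data s t k (fun=> c) = [:: c; c; 0; 0]`_k.
Proof.
move=> st.
have h x : diffquot_filter s t (fun=> c) x --> (0 : R) by apply: diffquot_cst.
split; first by split; apply/cvg_ex; eexists; exact: h.
move=> k; rewrite /hermite_data (derive_on_val st (lbound_in_itv st) (h _)).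
by rewrite (derive_on_val st (ubound_in_itv st) (h _)).
Qed.

Lemma hermite_data_sum s t n (F : 'I_n -> R -> R) (c : 'I_n -> R) : s < t ->
  (forall i, derivable_ends s t (F i)) ->
  derivable_ends s t (fun x => \sum_i c i * F i x) /\
  forall k, hermite_data s t k (fun x => \sum_i c i * F i x) =
    \sum_i c i * hermite_data s t k (F i).
Proof.
move=> st dF; elim: (index_enum _) => [|i r [dr IH]].
  under eq_fun do rewrite big_nil.
  have [d0 h0] := hermite_data_cst 0 st; split=> // k.
  by rewrite big_nil h0; case: k => [|[|[|[|k]]]] //=; rewrite nth_nil.
under eq_fun do rewrite big_cons addrC.
have [d h] := hermite_data_lin (c i) st dr (dF i); split=> // k.
by rewrite h IH big_cons addrC.
Qed.

Lemma is_derive_cubic (p : R -> R) (dp a b x : R) : is_derive x 1 p dp ->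
  is_derive x 1 (fun z => a * p z ^+ 2 + b * p z ^+ 3)
    ((2 * a * p x + 3 * b * p x ^+ 2) * dp).
Proof.
move=> dpx.
have : is_derive x 1 (a *: (p ^+ 2) + b *: (p ^+ 3) : R -> R)
  (a *: ((2%:R * p x ^+ 1) *: dp) + b *: ((3%:R * p x ^+ 2) *: dp)).
  by apply: is_deriveD.
rewrite /GRing.scale /=; congr (is_derive _ _ _ _); ring.
Qed.

Lemma is_derive_phi0 s t x : is_derive x 1 (phi0 s t) (- (t - s)^-1).
Proof.
have : is_derive x 1 ((t - s)^-1 *: (cst t - id) : R -> R) ((t - s)^-1 *: (0 - 1)).
  by apply: is_deriveZ; apply: is_deriveB.
rewrite /GRing.scale /= sub0r mulrN1; congr (is_derive _ _ _ _).
by apply/funext => z; rewrite /phi0 mulrC.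
Qed.

Lemma is_derive_phi1 s t x : is_derive x 1 (phi1 s t) (t - s)^-1.
Proof.
have : is_derive x 1 ((t - s)^-1 *: (id - cst s) : R -> R) ((t - s)^-1 *: (1 - 0)).
  by apply: is_deriveZ; apply: is_deriveB.
rewrite /GRing.scale /= subr0 mulr1; congr (is_derive _ _ _ _).
by apply/funext => z; rewrite /phi1 mulrC.
Qed.

Lemma diffquot_cubic s t (p : R -> R) (dp a b x : R) : is_derive x 1 p dp ->
  diffquot_filter s t (fun z => a * p z ^+ 2 + b * p z ^+ 3) x -->
    (2 * a * p x + 3 * b * p x ^+ 2) * dp.
Proof. by move=> dpx; apply: is_derive_diffquot; apply: is_derive_cubic. Qed.

(** The coefficients of the square and of the cube in the expression of each
    basis function as a polynomial in phi_0 (for even [k]) or phi_1 (for odd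
    [k]). *)
Definition hermite_basis_coef s t k : R * R :=
  nth (0, 0) [:: (3, -2); (3, -2); (t - s, s - t); (s - t, t - s)] k.

Lemma hermite_basisE s t (k : 'I_4) : s < t -> hermite_basis s t k =
  (fun z => (hermite_basis_coef s t k).1 *
      (if odd k then phi1 s t z else phi0 s t z) ^+ 2 +
    (hermite_basis_coef s t k).2 *
      (if odd k then phi1 s t z else phi0 s t z) ^+ 3).
Proof.
move=> st; apply/funext => z; rewrite /hermite_basis /hermite_basis_coef.
have [D0 D1] : derive1 (phi0 s t) s = - (t - s)^-1 /\
               derive1 (phi1 s t) t = (t - s)^-1.
  split; rewrite derive1E.
    by have [_ ->] := is_derive_phi0 s t s.
  by have [_ ->] := is_derive_phi1 s t t.
case: k => [[|[|[|[|k]]]] lk] //=; rewrite /psi0 /psi1 /varphi0 /varphi1 ?D0 ?D1.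
- by ring.
- by ring.
- by rewrite invrN invrK; ring.
- by rewrite invrK; ring.
Qed.

(** The cubics of [hermite_basis] are dual to the functionals [hermite_data]. *)
Lemma hermite_data_basis s t (l : 'I_4) : s < t ->
  derivable_ends s t (hermite_basis s t l) /\
  forall k : 'I_4, hermite_data s t k (hermite_basis s t l) = (k == l)%:R.
Proof.
move=> st; rewrite (hermite_basisE l st).
set p := if odd l then phi1 s t else phi0 s t.
rewrite (_ : (fun z => _) = (fun z => (hermite_basis_coef s t l).1 * p z ^+ 2 +
    (hermite_basis_coef s t l).2 * p z ^+ 3)); last first.
  by apply/funext => z; rewrite /p; case: odd.
set dp := if odd l then (t - s)^-1 else - (t - s)^-1.
have dpx x : is_derive x 1 p dp.
  by rewrite /p /dp; case: odd; [apply: is_derive_phi1|apply: is_derive_phi0].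
have h x := @diffquot_cubic s t p dp (hermite_basis_coef s t l).1
   (hermite_basis_coef s t l).2 x (dpx x).
split; first by split; apply/cvg_ex; eexists; exact: h.
move=> k; rewrite /hermite_data (derive_on_val st (lbound_in_itv st) (h _)).
rewrite (derive_on_val st (ubound_in_itv st) (h _)).
have ts : t - s != 0 by rewrite subr_eq0 gt_eqF.
rewrite /p /dp /hermite_basis_coef {h p dp dpx}.
case: l => [[|[|[|[|l]]]] ll] //=; case: k => [[|[|[|[|k]]]] lk] //=;
  by rewrite /phi0 /phi1; field.
Qed.

(** The scalar 1 gives the right-hand side the shape used in
    [hermite_data_lin]. *)
Lemma hermite_correctE s t f v0 v1 d0 d1 :
  hermite_correct s t f v0 v1 d0 d1 = fun x =>
  f x + 1 * \sum_(k < 4) ([:: v0; v1; d0; d1]`_k - hermite_data s t k f) *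
    hermite_basis s t k x.
Proof.
apply/funext => x.
rewrite /hermite_correct !big_ord_recr big_ord0 /=.
by rewrite /hermite_data /hermite_basis /=; ring.
Qed.

Lemma sum_delta (c : 'I_4 -> R) (k : 'I_4) : \sum_i c i * (k == i)%:R = c k.
Proof.
rewrite (bigD1 k) //= eqxx mulr1 big1 ?addr0 // => i ik.
by rewrite eq_sym (negPf ik) mulr0.
Qed.

Lemma hermite_data_correct s t f v0 v1 d0 d1 : s < t -> derivable_ends s t f ->
  derivable_ends s t (hermite_correct s t f v0 v1 d0 d1) /\
  forall k : 'I_4, hermite_data s t k (hermite_correct s t f v0 v1 d0 d1) =
    [:: v0; v1; d0; d1]`_k.
Proof.
move=> st df.
rewrite hermite_correctE.
have [ds hs] := hermite_data_sum (F := fun k : 'I_4 => hermite_basis s t k)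
  (fun k : 'I_4 => [:: v0; v1; d0; d1]`_k - hermite_data s t k f) st
  (fun k : 'I_4 => (hermite_data_basis k st).1).
have [d h] := hermite_data_lin 1 st df ds; split=> // k.
rewrite h hs (eq_bigr _ (fun i _ => congr1 _ ((hermite_data_basis i st).2 k))).
by rewrite sum_delta mul1r addrC subrK.
Qed.

Lemma hermite_correct_id s t f x :
  hermite_correct s t f (f s) (f t) (derive_on s t f s) (derive_on s t f t) x =
  f x.
Proof. by rewrite /hermite_correct !subrr !mul0r !addr0. Qed.

End HermiteFunctionals.

(** * Boolean sums of Hermite interpolants *)

Section BooleanSum.
Context {R : realType}.
Implicit Types (s t c d x y : R) (H G : nat -> R -> R) (C : nat -> nat -> R).

(** The transfinite interpolant on [`[s, t] `*` `[c, d]] with data [H] on the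
    horizontal edges, [G] on the vertical ones, and [C] at the corners.  In
    [C k l], [k] refers to the variable x and [l] to y. *)
Definition boolean_sum s t c d H G C x y : R :=
  \sum_(l < 4) hermite_basis c d l y * H l x
  + \sum_(k < 4) G k y * hermite_basis s t k x
  - \sum_(k < 4) (\sum_(l < 4) C k l * hermite_basis c d l y) *
      hermite_basis s t k x.

Lemma boolean_sum_swap s t c d H G C x y :
  boolean_sum s t c d H G C x y =
  boolean_sum c d s t G H (fun l k => C k l) y x.
Proof.
rewrite /boolean_sum; congr (_ - _).
  by rewrite addrC; congr (_ + _); apply: eq_bigr => k _; rewrite mulrC.
under eq_bigr do rewrite mulr_suml.
under [RHS]eq_bigr do rewrite mulr_suml.
rewrite exchange_big; apply: eq_bigr => l _; apply: eq_bigr => k _.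
by rewrite mulrAC.
Qed.

(** If the data of [H] at the corners are [C], then, by duality, the first and
    the last term have the same data, and the middle term has the data [G]. *)
Lemma hermite_data_boolean_sum s t c d H G C y : s < t ->
  (forall l : 'I_4, derivable_ends s t (H l)) ->
  (forall k l : 'I_4, hermite_data s t k (H l) = C k l) ->
  derivable_ends s t (boolean_sum s t c d H G C ^~ y) /\
  forall k : 'I_4, hermite_data s t k (boolean_sum s t c d H G C ^~ y) = G k y.
Proof.
move=> st dH HC.
have [d1 h1] := hermite_data_sum (fun l : 'I_4 => hermite_basis c d l y) st dH.
have db (k : 'I_4) := (hermite_data_basis k st).1.
have [d2 h2] := hermite_data_sum (fun k : 'I_4 => G k y) st db.
have [d3 h3] := hermite_data_sum
  (fun k : 'I_4 => \sum_(l < 4) C k l * hermite_basis c d l y) st db.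
have [d12 h12] := hermite_data_lin 1 st d1 d2.
have [d123 h123] := hermite_data_lin (-1) st d12 d3.
rewrite (_ : (boolean_sum _ _ _ _ _ _ _)^~ y = fun x =>
    \sum_(l < 4) hermite_basis c d l y * H l x
    + 1 * \sum_(k < 4) G k y * hermite_basis s t k x
    + -1 * \sum_(k < 4) (\sum_(l < 4) C k l * hermite_basis c d l y) *
      hermite_basis s t k x); last first.
  by apply/funext => x; rewrite mulN1r mul1r.
split=> // k; rewrite h123 h12 h1 h2 h3.
rewrite (eq_bigr _ (fun l _ => congr1 _ (HC k l))).
under [X in _ + 1 * X + _]eq_bigr do rewrite (hermite_data_basis _ st).2.
under [X in _ + _ + -1 * X]eq_bigr do rewrite (hermite_data_basis _ st).2.
rewrite !sum_delta mul1r mulN1r addrAC.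
by under eq_bigr do rewrite mulrC; rewrite subrr add0r.
Qed.

Lemma wvec_mx5_boolean_sum s t c d H G C x y :
  ((wvec s t x)^T *m
   mx5 [:: [:: 0; H 0%N x; H 1%N x; H 2%N x; H 3%N x];
           [:: G 0%N y; - C 0%N 0%N; - C 0%N 1%N; - C 0%N 2%N; - C 0%N 3%N];
           [:: G 1%N y; - C 1%N 0%N; - C 1%N 1%N; - C 1%N 2%N; - C 1%N 3%N];
           [:: G 2%N y; - C 2%N 0%N; - C 2%N 1%N; - C 2%N 2%N; - C 2%N 3%N];
           [:: G 3%N y; - C 3%N 0%N; - C 3%N 1%N; - C 3%N 2%N; - C 3%N 3%N]] *m
   wvec c d y) 0 0 = boolean_sum s t c d H G C x y.
Proof.
rewrite /boolean_sum !mxE !big_ord_recr !big_ord0 /=.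
rewrite !mxE !big_ord_recr !big_ord0 /= !mxE /= /hermite_basis /=; ring.
Qed.
End BooleanSum.

(** * Boundary data of a function on a rectangle *)

Section RectangleTraces.
Context {R : realType}.

(** The values of [g] on the lower and upper edges, then those of its
    y-derivative. *)
Definition hor_data (c d : R) (g : R -> R -> R) (l : nat) (x : R) : R :=
  hermite_data c d l (g x).

(** The values of [g] on the left and right edges, then those of its
    x-derivative. *)
Definition ver_data (s t : R) (g : R -> R -> R) (k : nat) (y : R) : R :=
  hermite_data s t k (g^~ y).

(** For [k], [l >= 2] this is the mixed derivative taken first in y, then in
    x. *)
Definition corner_data (s t c d : R) (g : R -> R -> R) (k l : nat) : R :=
  hermite_data s t k (hor_data c d g l).

Variables (s t c d : R) (g : R -> R -> R).
Hypotheses (st : s < t) (cd : c < d) (gC2 : C2_rect s t c d g).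

(** Taking the data first in x, then in y, gives the same corner data; Schwarz's
    theorem is needed when both are derivatives. *)
Lemma hermite_data_ver_data (k l : 'I_4) :
  hermite_data c d l (ver_data s t g k) = corner_data s t c d g k l.
Proof.
have schwarz x y : x \in `[s, t] -> y \in `[c, d] ->
    derive_on s t (fun x => derive_on c d (g x) y) x =
    derive_on c d (fun y => derive_on s t (g^~ y) x) y.
  exact: Dx_DyC.
case: k => [[|[|[|[|k]]]] lk] //; case: l => [[|[|[|[|l]]]] ll] //;
  apply/esym; rewrite ?/corner_data ?/hor_data ?/ver_data /hermite_data /=;
  apply: schwarz;
  by [apply: lbound_in_itv | apply: ubound_in_itv].
Qed.

Lemma derivable_ends_hor_data (l : 'I_4) :
  derivable_ends s t (hor_data c d g l).
Proof.
have [C1g _ C1gy] := gC2.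
have ccd := lbound_in_itv cd; have dcd := ubound_in_itv cd.
case: l => [[|[|[|[|l]]]] ll] //; apply: C1_itv_ends => //.
- exact: C1_rect_C1_x C1g ccd.
- exact: C1_rect_C1_x C1g dcd.
- exact: C1_rect_C1_x C1gy ccd.
- exact: C1_rect_C1_x C1gy dcd.
Qed.

Lemma derivable_ends_ver_data (k : 'I_4) :
  derivable_ends c d (ver_data s t g k).
Proof.
have [C1g C1gx _] := gC2.
have sst := lbound_in_itv st; have tst := ubound_in_itv st.
case: k => [[|[|[|[|k]]]] lk] //; apply: C1_itv_ends => //.
- exact: C1_rect_C1_y C1g sst.
- exact: C1_rect_C1_y C1g tst.
- exact: C1_rect_C1_y C1gx sst.
- exact: C1_rect_C1_y C1gx tst.
Qed.

Section Modified.
Variables (H G : nat -> R -> R) (C : nat -> nat -> R).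
Hypotheses (dH : forall l : 'I_4, derivable_ends s t (H l))
  (dG : forall k : 'I_4, derivable_ends c d (G k))
  (HC : forall k l : 'I_4, hermite_data s t k (H l) = C k l)
  (GC : forall k l : 'I_4, hermite_data c d l (G k) = C k l).

(** [g] with its boundary values and normal derivatives replaced by [H] on the
    horizontal edges and [G] on the vertical ones. *)
Definition with_boundary_data x y : R :=
  g x y
  - boolean_sum s t c d (hor_data c d g) (ver_data s t g)
      (corner_data s t c d g) x y
  + boolean_sum s t c d H G C x y.

Lemma with_boundary_data_x y : y \in `[c, d] ->
  derivable_ends s t (with_boundary_data^~ y) /\
  forall k : 'I_4, hermite_data s t k (with_boundary_data^~ y) = G k y.
Proof.
move=> ycd; have dg : derivable_ends s t (g^~ y).
  by case: gC2 => C1g _ _; apply: C1_itv_ends => //; apply: C1_rect_C1_x C1g ycd.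
have [d1 h1] := hermite_data_boolean_sum c d
  (ver_data s t g) y st derivable_ends_hor_data
  (C := corner_data s t c d g) (fun k l => erefl).
have [d2 h2] := hermite_data_boolean_sum c d G y st dH HC.
have [d3 h3] := hermite_data_lin (-1) st dg d1.
have [d4 h4] := hermite_data_lin 1 st d3 d2.
rewrite (_ : with_boundary_data^~ y = fun x => g x y
  + -1 * boolean_sum s t c d (hor_data c d g) (ver_data s t g)
      (corner_data s t c d g) x y
  + 1 * boolean_sum s t c d H G C x y); last first.
  by apply/funext => x; rewrite mulN1r mul1r.
by split=> // k; rewrite h4 h3 h1 h2 /ver_data; ring.
Qed.

Lemma with_boundary_data_y x : x \in `[s, t] ->
  derivable_ends c d (with_boundary_data x) /\
  forall l : 'I_4, hermite_data c d l (with_boundary_data x) = H l x.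
Proof.
move=> xst; have dg : derivable_ends c d (g x).
  by case: gC2 => C1g _ _; apply: C1_itv_ends => //; apply: C1_rect_C1_y C1g xst.
have [d1 h1] := hermite_data_boolean_sum s t
  (hor_data c d g) x cd derivable_ends_ver_data
  (C := fun l k => corner_data s t c d g k l)
  (fun l k => hermite_data_ver_data k l).
have [d2 h2] := hermite_data_boolean_sum s t H x cd dG
  (C := fun l k => C k l) (fun l k => GC k l).
have [d3 h3] := hermite_data_lin (-1) cd dg d1.
have [d4 h4] := hermite_data_lin 1 cd d3 d2.
rewrite (_ : with_boundary_data x = fun y => g x y
  + -1 * boolean_sum c d s t (ver_data s t g) (hor_data c d g)
      (fun l k => corner_data s t c d g k l) y x
  + 1 * boolean_sum c d s t G H (fun l k => C k l) y x); last first.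
  apply/funext => y; rewrite mulN1r mul1r /with_boundary_data.
  by rewrite (boolean_sum_swap s) [in X in _ + X](boolean_sum_swap s).
by split=> // l; rewrite h4 h3 h1 h2 /hor_data; ring.
Qed.
End Modified.
End RectangleTraces.

(** * The functions of the given form are C^1 across the edges *)

Section ElementData.
Context {R : realType}.
Variables (X Y : nat -> R) (D : free_data R).

(** The functions in the first row of Q_b. *)
Definition elem_H i j l : R -> R :=
  nth (fun=> 0) [:: H1 X D i j; H1 X D i j.+1; H2 X D i j; H2 X D i j.+1] l.

(** The functions in the first column of Q_b. *)
Definition elem_G i j k : R -> R :=
  nth (fun=> 0) [:: G1 Y D i j; G1 Y D i.+1 j; G2 Y D i j; G2 Y D i.+1 j] k.

(** The parameters in Q_b, without their sign. *)
Definition elem_C i j k l : R :=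
  (nth [::]
    [:: [:: alpha D i j; alpha D i j.+1; beta2 D i j; beta2 D i j.+1];
        [:: alpha D i.+1 j; alpha D i.+1 j.+1; beta2 D i.+1 j; beta2 D i.+1 j.+1];
        [:: beta1 D i j; beta1 D i j.+1; gamma D i j; gamma D i j.+1];
        [:: beta1 D i.+1 j; beta1 D i.+1 j.+1; gamma D i.+1 j; gamma D i.+1 j.+1]]
    k)`_l.

Lemma tfc_exprE i j x y : tfc_expr X Y D i j x y =
  with_boundary_data (X i) (X i.+1) (Y j) (Y j.+1) (fg D i j)
    (elem_H i j) (elem_G i j) (elem_C i j) x y.
Proof.
rewrite /tfc_expr /with_boundary_data -!wvec_mx5_boolean_sum.
reflexivity.
Qed.

Variables (Nx Ny : nat).
Hypothesis DR : free_data_regular Nx Ny X Y D.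
Hypotheses (Xlt : forall i, (i < Nx)%N -> X i < X i.+1)
  (Ylt : forall j, (j < Ny)%N -> Y j < Y j.+1).

Lemma elem_H_data i j (l : 'I_4) : (i < Nx)%N -> (j < Ny)%N ->
  derivable_ends (X i) (X i.+1) (elem_H i j l) /\
  forall k : 'I_4, hermite_data (X i) (X i.+1) k (elem_H i j l) = elem_C i j k l.
Proof.
move=> iN jN; have [_ _ hH] := DR; have xlt := Xlt iN.
have [/(C1_itv_ends xlt) h1 /(C1_itv_ends xlt) h2] := hH i j iN (ltnW jN).
have [/(C1_itv_ends xlt) h3 /(C1_itv_ends xlt) h4] := hH i j.+1 iN jN.
case: l => [[|[|[|[|l]]]] ll] //; rewrite /elem_H /= /H1 /H2.
- have [? h] := hermite_data_correct (alpha D i j) (alpha D i.+1 j)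
    (beta1 D i j) (beta1 D i.+1 j) xlt h1.
  by split=> // k; rewrite h; case: k => [[|[|[|[|k]]]] lk].
- have [? h] := hermite_data_correct (alpha D i j.+1) (alpha D i.+1 j.+1)
    (beta1 D i j.+1) (beta1 D i.+1 j.+1) xlt h3.
  by split=> // k; rewrite h; case: k => [[|[|[|[|k]]]] lk].
- have [? h] := hermite_data_correct (beta2 D i j) (beta2 D i.+1 j)
    (gamma D i j) (gamma D i.+1 j) xlt h2.
  by split=> // k; rewrite h; case: k => [[|[|[|[|k]]]] lk].
- have [? h] := hermite_data_correct (beta2 D i j.+1) (beta2 D i.+1 j.+1)
    (gamma D i j.+1) (gamma D i.+1 j.+1) xlt h4.
  by split=> // k; rewrite h; case: k => [[|[|[|[|k]]]] lk].
Qed.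

Lemma elem_G_data i j (k : 'I_4) : (i < Nx)%N -> (j < Ny)%N ->
  derivable_ends (Y j) (Y j.+1) (elem_G i j k) /\
  forall l : 'I_4, hermite_data (Y j) (Y j.+1) l (elem_G i j k) = elem_C i j k l.
Proof.
move=> iN jN; have [_ hG _] := DR; have ylt := Ylt jN.
have [/(C1_itv_ends ylt) h1 /(C1_itv_ends ylt) h2] := hG i j (ltnW iN) jN.
have [/(C1_itv_ends ylt) h3 /(C1_itv_ends ylt) h4] := hG i.+1 j iN jN.
case: k => [[|[|[|[|k]]]] lk] //; rewrite /elem_G /= /G1 /G2.
- have [? h] := hermite_data_correct (alpha D i j) (alpha D i j.+1)
    (beta2 D i j) (beta2 D i j.+1) ylt h1.
  by split=> // l; rewrite h.
- have [? h] := hermite_data_correct (alpha D i.+1 j) (alpha D i.+1 j.+1)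
    (beta2 D i.+1 j) (beta2 D i.+1 j.+1) ylt h3.
  by split=> // l; rewrite h.
- have [? h] := hermite_data_correct (beta1 D i j) (beta1 D i j.+1)
    (gamma D i j) (gamma D i j.+1) ylt h2.
  by split=> // l; rewrite h.
- have [? h] := hermite_data_correct (beta1 D i.+1 j) (beta1 D i.+1 j.+1)
    (gamma D i.+1 j) (gamma D i.+1 j.+1) ylt h4.
  by split=> // l; rewrite h.
Qed.

Variable u : nat -> nat -> R -> R -> R.
Hypothesis uD : has_tfc_form Nx Ny X Y D u.

(** The data of [u] in the variable x, on the vertical edges of an element, are
    the functions [G] attached to these edges. *)
Lemma tfc_form_data_x i j y : (i < Nx)%N -> (j < Ny)%N ->
  y \in `[Y j, Y j.+1] ->
  derivable_ends (X i) (X i.+1) ((u i j)^~ y) /\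
  forall k : 'I_4, hermite_data (X i) (X i.+1) k ((u i j)^~ y) = elem_G i j k y.
Proof.
move=> iN jN yj; have [C2g _ _] := DR.
have eu : {in `[X i, X i.+1], (with_boundary_data (X i) (X i.+1) (Y j) (Y j.+1)
    (fg D i j) (elem_H i j) (elem_G i j) (elem_C i j))^~ y =1 (u i j)^~ y}.
  by move=> x xi; rewrite uD // tfc_exprE.
have [d h] := with_boundary_data_x (Xlt iN) (Ylt jN) (C2g i j iN jN)
  (elem_G i j) (fun l => (elem_H_data l iN jN).1)
  (fun k l => (elem_H_data l iN jN).2 k) yj.
split; first exact: eq_derivable_ends (Xlt iN) eu d.
by move=> k; rewrite -h (eq_hermite_data _ (Xlt iN) eu).
Qed.

Lemma tfc_form_data_y i j x : (i < Nx)%N -> (j < Ny)%N ->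
  x \in `[X i, X i.+1] ->
  derivable_ends (Y j) (Y j.+1) (u i j x) /\
  forall l : 'I_4, hermite_data (Y j) (Y j.+1) l (u i j x) = elem_H i j l x.
Proof.
move=> iN jN xi; have [C2g _ _] := DR.
have eu : {in `[Y j, Y j.+1], with_boundary_data (X i) (X i.+1) (Y j) (Y j.+1)
    (fg D i j) (elem_H i j) (elem_G i j) (elem_C i j) x =1 u i j x}.
  by move=> y yj; rewrite uD // tfc_exprE.
have [d h] := with_boundary_data_y (Xlt iN) (Ylt jN) (C2g i j iN jN)
  (elem_H i j) (fun k => (elem_G_data k iN jN).1)
  (fun k l => (elem_G_data k iN jN).2 l) xi.
split; first exact: eq_derivable_ends (Ylt jN) eu d.
by move=> k; rewrite -h (eq_hermite_data _ (Ylt jN) eu).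
Qed.

Lemma tfc_form_C1_continuity : C1_continuity Nx Ny X Y u.
Proof.
(* The upper end of an element (indices 1 and 3) is the lower end of the next
   one (indices 0 and 2). *)
pose o k (kP : (k < 4)%N) := Ordinal kP.
split=> [i j y iN jN yj|i j x iN jN xi].
- have [[_ dl] hl] := tfc_form_data_x (ltnW iN) jN yj.
  have [[dr _] hr] := tfc_form_data_x iN jN yj.
  split=> //.
    exact: etrans (hl (o 1%N isT)) (esym (hr (o 0%N isT))).
  exact: etrans (hl (o 3%N isT)) (esym (hr (o 2%N isT))).
- have [[_ dl] hl] := tfc_form_data_y iN (ltnW jN) xi.
  have [[dr _] hr] := tfc_form_data_y iN jN xi.
  split=> //.
    exact: etrans (hl (o 1%N isT)) (esym (hr (o 0%N isT))).
  exact: etrans (hl (o 3%N isT)) (esym (hr (o 2%N isT))).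
Qed.
End ElementData.

(** * Representation of piecewise C^2 functions *)

Section Representation.
Context {R : realType}.
Variables (Nx Ny : nat) (X Y : nat -> R) (u : nat -> nat -> R -> R -> R).
Hypotheses (Nx0 : (1 <= Nx)%N) (Ny0 : (1 <= Ny)%N)
  (Xlt : forall i, (i < Nx)%N -> X i < X i.+1)
  (Ylt : forall j, (j < Ny)%N -> Y j < Y j.+1)
  (uC2 : C2_elements Nx Ny X Y u) (uC1 : C1_continuity Nx Ny X Y u).

(** The index of a cell having the node [n] as an endpoint: the cell starting
    at [n], except for the last node, which ends the last cell. *)
Definition node_cell (N n : nat) : nat := minn n N.-1.

Lemma node_cell_lt N n : (1 <= N)%N -> (node_cell N n < N)%N.
Proof. rewrite /node_cell; lia. Qed.

Lemma node_cell_adj N n : (1 <= N)%N -> (n <= N)%N ->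
  (node_cell N n <= n <= (node_cell N n).+1)%N.
Proof. rewrite /node_cell; lia. Qed.

(** For a node [n] of the cell [i], either [i] is the chosen cell, or [n] is
    interior to the mesh and the chosen cell is the next one. *)
Lemma node_cellP N i n : (i < N)%N -> (i <= n <= i.+1)%N ->
  node_cell N n = i \/ [/\ node_cell N n = i.+1, n = i.+1 & (i.+1 < N)%N].
Proof.
rewrite /node_cell => iN ni.
have [->|] := eqVneq n i; first by left; lia.
move=> h; have [h'|h'] := ltnP i.+1 N; [right; split|left]; lia.
Qed.

Lemma grid_in_itv (N : nat) (Z : nat -> R) i n :
  (forall i, (i < N)%N -> Z i < Z i.+1) ->
  (i < N)%N -> (i <= n <= i.+1)%N -> Z n \in `[Z i, Z i.+1].
Proof.
move=> Zlt iN ni; have [->|h] := eqVneq n i; first exact: lbound_in_itv (Zlt i iN).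
have -> : n = i.+1 by lia.
exact: ubound_in_itv (Zlt i iN).
Qed.

Local Notation ux i j := (Dx (X i) (X i.+1) (u i j)).
Local Notation uy i j := (Dy (Y j) (Y j.+1) (u i j)).
Local Notation uxy i j := (Dx (X i) (X i.+1) (uy i j)).
Local Notation cx := (node_cell Nx).
Local Notation cy := (node_cell Ny).

(** [u] and [u_x] on a vertical edge do not depend on the element from which
    they are computed. *)
Lemma edge_agree_x i j n y : (i < Nx)%N -> (j < Ny)%N -> (i <= n <= i.+1)%N ->
  y \in `[Y j, Y j.+1] ->
  u (cx n) j (X n) y = u i j (X n) y /\ ux (cx n) j (X n) y = ux i j (X n) y.
Proof.
move=> iN jN ni yj; have [->//|[-> -> iN']] := node_cellP iN ni.
by have [-> _ _ ->] := uC1.1 i j y iN' jN yj.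
Qed.

(** The same for [u] and [u_y] on a horizontal edge. *)
Lemma edge_agree_y i j m x : (i < Nx)%N -> (j < Ny)%N -> (j <= m <= j.+1)%N ->
  x \in `[X i, X i.+1] ->
  u i (cy m) x (Y m) = u i j x (Y m) /\ uy i (cy m) x (Y m) = uy i j x (Y m).
Proof.
move=> iN jN mj xi; have [->//|[-> -> jN']] := node_cellP jN mj.
by have [-> _ _ ->] := uC1.2 i j x iN jN' xi.
Qed.

(** The values of [u], [u_x], [u_y] and [u_xy] at the node [(n, m)], computed
    in the element [(i, j)]. *)
Definition node_values i j n m : R * R * R * R :=
  (u i j (X n) (Y m), ux i j (X n) (Y m), uy i j (X n) (Y m), uxy i j (X n) (Y m)).

Lemma uxyC i j n m : (i < Nx)%N -> (j < Ny)%N ->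
  (i <= n <= i.+1)%N -> (j <= m <= j.+1)%N ->
  uxy i j (X n) (Y m) = Dy (Y j) (Y j.+1) (ux i j) (X n) (Y m).
Proof.
move=> iN jN ni mj; apply: Dx_DyC (Xlt iN) (Ylt jN) (uC2 iN jN) _ _.
  exact: grid_in_itv Xlt iN ni.
exact: grid_in_itv Ylt jN mj.
Qed.

Lemma node_values_x i j n m : (i < Nx)%N -> (j < Ny)%N ->
  (i <= n <= i.+1)%N -> (j <= m <= j.+1)%N ->
  node_values (cx n) j n m = node_values i j n m.
Proof.
move=> iN jN ni mj; have Ym := grid_in_itv Ylt jN mj.
have [-> //|[cE nE iN']] := node_cellP iN ni.
have cn : (cx n <= n <= (cx n).+1)%N by rewrite cE nE leqnn leqnSn.
have cN : (cx n < Nx)%N by rewrite cE.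
have e y := edge_agree_x iN jN ni (y := y).
(* Only [u] and [u_x] are known to match on the edge, so that the mixed
   derivative has to be computed as that of [u_x] along the edge. *)
rewrite /node_values (uxyC cN jN cn mj) (uxyC iN jN ni mj).
rewrite (e _ Ym).1 (e _ Ym).2; congr (_, _, _, _).
  by apply: eq_derive_on Ym _ => y yj; have [] := e y yj.
by apply: eq_derive_on Ym _ => y yj; have [] := e y yj.
Qed.

Lemma node_values_y i j n m : (i < Nx)%N -> (j < Ny)%N ->
  (i <= n <= i.+1)%N -> (j <= m <= j.+1)%N ->
  node_values i (cy m) n m = node_values i j n m.
Proof.
move=> iN jN ni mj; have Xn := grid_in_itv Xlt iN ni.
have e x := edge_agree_y iN jN mj (x := x).
rewrite /node_values (e _ Xn).1 (e _ Xn).2; congr (_, _, _, _).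
  by apply: eq_derive_on Xn _ => x xi; have [] := e x xi.
by apply: eq_derive_on Xn _ => x xi; have [] := e x xi.
Qed.

(** The traces of [u] and of its derivatives, each computed in a fixed element
    adjacent to the edge or node. *)
Definition trace_data : free_data R := {|
  fg := u;
  hG1 := fun n j => u (cx n) j (X n);
  hG2 := fun n j => ux (cx n) j (X n);
  hH1 := fun i m x => u i (cy m) x (Y m);
  hH2 := fun i m x => uy i (cy m) x (Y m);
  alpha := fun n m => u (cx n) (cy m) (X n) (Y m);
  beta1 := fun n m => ux (cx n) (cy m) (X n) (Y m);
  beta2 := fun n m => uy (cx n) (cy m) (X n) (Y m);
  gamma := fun n m => uxy (cx n) (cy m) (X n) (Y m) |}.

Lemma trace_data_regular : free_data_regular Nx Ny X Y trace_data.
Proof.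
split=> // [n j nN jN|i m iN mN] /=.
- have [C1u C1x _] := uC2 (node_cell_lt n Nx0) jN.
  have Xn := grid_in_itv Xlt (node_cell_lt n Nx0) (node_cell_adj Nx0 nN).
  by split; [apply: C1_rect_C1_y C1u Xn|apply: C1_rect_C1_y C1x Xn].
- have [C1u _ C1y] := uC2 iN (node_cell_lt m Ny0).
  have Ym := grid_in_itv Ylt (node_cell_lt m Ny0) (node_cell_adj Ny0 mN).
  by split; [apply: C1_rect_C1_x C1u Ym|apply: C1_rect_C1_x C1y Ym].
Qed.

(** The Hermite corrections of the traces vanish. *)
Lemma trace_G n j y : (n <= Nx)%N -> (j < Ny)%N ->
  G1 Y trace_data n j y = u (cx n) j (X n) y /\
  G2 Y trace_data n j y = ux (cx n) j (X n) y.
Proof.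
move=> nN jN; have cN := node_cell_lt n Nx0; have nn := node_cell_adj Nx0 nN.
have jj : (j <= j <= j.+1)%N by rewrite leqnn leqnSn.
have jj' : (j <= j.+1 <= j.+1)%N by rewrite leqnn leqnSn.
have [a0 b0 c0 d0] := node_values_y cN jN nn jj.
have [a1 b1 c1 d1] := node_values_y cN jN nn jj'.
rewrite /G1 /G2 /= a0 b0 c0 d0 a1 b1 c1 d1 !uxyC //.
by split; apply: hermite_correct_id.
Qed.

Lemma trace_H i m x : (i < Nx)%N -> (m <= Ny)%N ->
  H1 X trace_data i m x = u i (cy m) x (Y m) /\
  H2 X trace_data i m x = uy i (cy m) x (Y m).
Proof.
move=> iN mN; have cN := node_cell_lt m Ny0; have mm := node_cell_adj Ny0 mN.
have ii : (i <= i <= i.+1)%N by rewrite leqnn leqnSn.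
have ii' : (i <= i.+1 <= i.+1)%N by rewrite leqnn leqnSn.
have [a0 b0 c0 d0] := node_values_x iN cN ii mm.
have [a1 b1 c1 d1] := node_values_x iN cN ii' mm.
rewrite /H1 /H2 /= a0 b0 c0 d0 a1 b1 c1 d1.
split; first exact: (hermite_correct_id _ _ (fun x => u i (cy m) x (Y m))).
exact: (hermite_correct_id _ _ (fun x => uy i (cy m) x (Y m))).
Qed.

Lemma trace_data_form : has_tfc_form Nx Ny X Y trace_data u.
Proof.
move=> i j iN jN x y xi yj; rewrite /tfc_expr.
suff -> : Qb X Y trace_data i j x y = Qg X Y trace_data i j x y by rewrite subrK.
have ii : (i <= i <= i.+1)%N by rewrite leqnn leqnSn.
have ii' : (i <= i.+1 <= i.+1)%N by rewrite leqnn leqnSn.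
have jj : (j <= j <= j.+1)%N by rewrite leqnn leqnSn.
have jj' : (j <= j.+1 <= j.+1)%N by rewrite leqnn leqnSn.
have corner n m : (i <= n <= i.+1)%N -> (j <= m <= j.+1)%N ->
    node_values (cx n) (cy m) n m = node_values i j n m.
  move=> ni mj; have [nN mN] : (n <= Nx)%N /\ (m <= Ny)%N by lia.
  rewrite (node_values_y (node_cell_lt n Nx0) jN (node_cell_adj Nx0 nN) mj).
  exact: node_values_x.
have [a00 b00 c00 d00] := corner _ _ ii jj.
have [a01 b01 c01 d01] := corner _ _ ii jj'.
have [a10 b10 c10 d10] := corner _ _ ii' jj.
have [a11 b11 c11 d11] := corner _ _ ii' jj'.
have [g1 g2] := edge_agree_x iN jN ii yj.
have [g3 g4] := edge_agree_x iN jN ii' yj.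
have [h1 h2] := edge_agree_y iN jN jj xi.
have [h3 h4] := edge_agree_y iN jN jj' xi.
rewrite /Qb /Qg.
rewrite (trace_G y (ltnW iN) jN).1 (trace_G y (ltnW iN) jN).2.
rewrite (trace_G y iN jN).1 (trace_G y iN jN).2.
rewrite (trace_H x iN (ltnW jN)).1 (trace_H x iN (ltnW jN)).2.
rewrite (trace_H x iN jN).1 (trace_H x iN jN).2 /=.
rewrite g1 g2 g3 g4 h1 h2 h3 h4.
by rewrite a00 b00 c00 d00 a01 b01 c01 d01 a10 b10 c10 d10 a11 b11 c11 d11.
Qed.
End Representation.

Theorem theorem7 (R : realType) (Nx Ny : nat) (a1 b1 a2 b2 : R)
    (X Y : nat -> R)
    (hNx : (1 <= Nx)%N) (hNy : (1 <= Ny)%N)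
    (hX : is_grid Nx a1 b1 X) (hY : is_grid Ny a2 b2 Y) :
  (forall D : free_data R, free_data_regular Nx Ny X Y D ->
   forall u : nat -> nat -> R -> R -> R,
     has_tfc_form Nx Ny X Y D u -> C1_continuity Nx Ny X Y u) /\
  (forall u : nat -> nat -> R -> R -> R,
     C2_elements Nx Ny X Y u -> C1_continuity Nx Ny X Y u ->
   exists D : free_data R,
     free_data_regular Nx Ny X Y D /\ has_tfc_form Nx Ny X Y D u).
Proof.
have [_ _ Xlt] := hX; have [_ _ Ylt] := hY.
split=> [D DR u uD|u uC2 uC1]; first exact: tfc_form_C1_continuity DR Xlt Ylt u uD.
exists (trace_data Nx Ny X Y u).
by split; [apply: trace_data_regular|apply: trace_data_form].
Qed.
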